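(* Let $n\geq 8$ and let $B_n$ be the set of $C_4$-free bicyclic graphs of order $n$. Let $G_4,G_5,G_6\in B_n$ be the graphs of order $n$ defined in the context. Then for any $G\in B_n$ that is not isomorphic to any of $G_4,G_5,G_6$, we have $$q(G)<q(G_{6})<q(G_{5})<q(G_{4}).$$
   Context: All graphs are finite and simple. A bicyclic graph of order $n$ is a connected graph with $n$ vertices and $n+1$ edges. A graph is $C_4$-free if it has no (not necessarily induced) subgraph isomorphic to the cycle $C_4$ on 4 vertices. For a graph $G$ with adjacency matrix $A(G)$ and diagonal matrix of vertex degrees $D(G)$, $Q(G)=D(G)+A(G)$ is the signless Laplacian matrix and $q(G)$ denotes its largest eigenvalue. The graphs, each of order $n$, are: - $G_4=K_1\vee(2K_2\cup(n-5)K_1)$: two triangles sharing exactly one common vertex $w$, with $n-5$ pendant vertices attached to $w$. - $G_5$: two triangles sharing exactly one common vertex $w$, with $n-6$ pendant vertices attached to $w$ and one pendant vertex attached to one of the four triangle vertices other than $w$. - $G_6$: two triangles sharing exactly one common vertex $w$, with $n-7$ pendant vertices attached to $w$, and a pendant path of length 2 attached at $w$ (a vertex $c$ adjacent to $w$, and a vertex $z$ adjacent only to $c$). *)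

(* Defs.v *)
From mathcomp Require Import all_boot all_order all_algebra.
From mathcomp Require Import all_classical all_reals.
From mathcomp Require complex polyrcf.
Set Implicit Arguments.
Unset Strict Implicit.
Unset Printing Implicit Defensive.
Import Order.TTheory GRing.Theory Num.Theory.
Local Open Scope ring_scope.

Record sgraph (n : nat) := SGraph {
  adj :> rel 'I_n;
  adj_sym : symmetric adj;
  adj_irrefl : irreflexive adj }.

Section Graph.
Variable n : nat.
Implicit Types G : sgraph n.

Definition deg G (i : 'I_n) : nat := #|[set j | G i j]%SET|.

Definition edges G : {set {set 'I_n}} :=
  [set [set p.1; p.2] | p : 'I_n * 'I_n & G p.1 p.2]%SET.

Definition connected G : Prop := forall i j, connect G i j.

Definition bicyclic G : Prop := connected G /\ #|edges G| = n.+1.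

(* The simple graph on {0, ..., n-1} whose edges are the pairs {i, j}, i != j,
   such that [E i j] or [E j i]. *)
Definition mkadj (E : rel nat) : rel 'I_n :=
  fun i j => (i != j) && (E i j || E j i).

Lemma mkadj_sym E : symmetric (mkadj E).
Proof. by move=> i j; rewrite /mkadj eq_sym orbC. Qed.

Lemma mkadj_irrefl E : irreflexive (mkadj E).
Proof. by move=> i; rewrite /mkadj eqxx. Qed.

Definition mkgraph (E : rel nat) : sgraph n :=
  SGraph (mkadj_sym E) (mkadj_irrefl E).

End Graph.

Definition isomorphic m n (H : sgraph m) (G : sgraph n) : Prop :=
  exists f : 'I_m -> 'I_n, bijective f /\ forall i j, G (f i) (f j) = H i j.

(* [G] has a (not necessarily induced) subgraph isomorphic to [H]. *)
Definition has_subgraph m n (H : sgraph m) (G : sgraph n) : Prop :=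
  exists f : 'I_m -> 'I_n, injective f /\ forall i j, H i j -> G (f i) (f j).

Definition C4 : sgraph 4 := mkgraph 4 (fun i j => j == i.+1 %% 4)%N.

Definition C4_free n (G : sgraph n) : Prop := ~ has_subgraph C4 G.

(* The class B_n of C4-free bicyclic graphs of order n. *)
Definition B n (G : sgraph n) : Prop := C4_free G /\ bicyclic G.

(* In the three graphs below w is the vertex 0 and the two triangles are
   {0, 1, 2} and {0, 3, 4}. *)

(* Pendant vertices at w: 5, ..., n-1. *)
Definition G4 n : sgraph n :=
  mkgraph n (fun i j => (i == 0) || ((i, j) \in [:: (1, 2); (3, 4)]))%N.

(* Pendant vertices at w: 5, ..., n-2; the vertex n-1 is pendant at 1. *)
Definition G5 n : sgraph n :=
  mkgraph n (fun i j => (i == 0) && (j < n.-1)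
                     || ((i, j) \in [:: (1, 2); (3, 4); (1, n.-1)]))%N.

(* Pendant vertices at w: 5, ..., n-3; the pendant path is 0 - (n-2) - (n-1),
   that is, c = n-2 and z = n-1. *)
Definition G6 n : sgraph n :=
  mkgraph n (fun i j => (i == 0) && (j < n.-1)
                     || ((i, j) \in [:: (1, 2); (3, 4); (n.-2, n.-1)]))%N.

Section Spectrum.
Variable R : realType.

Definition adjmx n (G : sgraph n) : 'M[R]_n := \matrix_(i, j) (G i j)%:R.

Definition degmx n (G : sgraph n) : 'M[R]_n :=
  diag_mx (\row_i (deg G i)%:R).

Definition signless_laplacian n (G : sgraph n) : 'M[R]_n :=
  degmx G + adjmx G.

(* Largest eigenvalue: for a symmetric matrix of positive size the supremum is
   a maximum, see [largest_eigenvalueP]. *)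
Definition largest_eigenvalue n (M : 'M[R]_n) : R :=
  sup [set a : R | eigenvalue M a]%classic.

Definition q n (G : sgraph n) : R := largest_eigenvalue (signless_laplacian G).

Lemma signless_laplacian_sym n (G : sgraph n) :
  (signless_laplacian G)^T = signless_laplacian G.
Proof.
apply/matrixP => i j; rewrite !mxE adj_sym eq_sym.
by case: eqVneq => [->|].
Qed.

Import complex.

Lemma sym_has_eigenvalue n (M : 'M[R]_n) :
  (0 < n)%N -> M^T = M -> exists a, eigenvalue M a.
Proof.
case: n M => // n M _ MT.
pose f := @real_complex R; pose Mc : 'M[R[i]]_n.+1 := map_mx f M.
have [z rz] : exists z, root (char_poly Mc) z.
  by apply/closed_rootP; rewrite size_char_poly.
have := rz; rewrite -eigenvalue_root_char => /eigenvalueP[v vM v0].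
pose vb := map_mx (@conjc R) v.
have Mb : map_mx (@conjc R) Mc = Mc.
  by apply/matrixP => i j; rewrite !mxE /f /= oppr0.
have McT : Mc^T = Mc by rewrite /Mc map_trmx MT.
have vbM : vb *m Mc = conjc z *: vb by rewrite -{1}Mb -map_mxM vM map_mxZ.
have E : z *: (v *m vb^T) = conjc z *: (v *m vb^T).
  by rewrite scalemxAl -vM -mulmxA -{1}McT -trmx_mul vbM linearZ /= -scalemxAr.
have vv0 : (v *m vb^T) 0 0 != 0.
  rewrite mxE psumr_neq0; last first.
    by move=> i _; rewrite !mxE; apply: mul_conjC_ge0.
  apply/hasP.
  have [i vi] : exists i, v 0 i != 0 by apply/rV0Pn.
  exists i; first by rewrite mem_index_enum.
  by rewrite !mxE; rewrite /= (mul_conjC_gt0 (v 0 i)).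
have zz : z = conjc z.
  by move/matrixP/(_ 0 0): E; rewrite !mxE; apply: mulIf; rewrite mxE in vv0.
exists (Re z); rewrite eigenvalue_root_char.
have -> : root (char_poly M) (Re z) = root (char_poly Mc) (f (Re z)).
  by rewrite /Mc -map_char_poly fmorph_root.
suff -> : f (Re z) = z by [].
case: z zz {rz vM vbM E} => a b /= [] /eqP.
by rewrite -subr_eq0 opprK -mulr2n mulrn_eq0 /= => /eqP ->.
Qed.

Lemma largest_eigenvalueP n (M : 'M[R]_n) : (0 < n)%N -> M^T = M ->
  eigenvalue M (largest_eigenvalue M) /\
  forall a, eigenvalue M a -> a <= largest_eigenvalue M.
Proof.
move=> n0 MT; have [a0 a0M] := sym_has_eigenvalue n0 MT.
pose s := polyrcf.rootsR (char_poly M).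
have p0 : char_poly M != 0 by apply: monic_neq0; apply: char_poly_monic.
have sE a : eigenvalue M a = (a \in s).
  rewrite eigenvalue_root_char -(polyrcf.roots_on_rootsR p0 a).
  by rewrite in_itv.
pose m := \big[Num.max/a0]_(x <- s) x.
have ms : m \in s.
  rewrite /m big_seq; elim/big_ind: _ => [|x y xs ys|//]; first by rewrite -sE.
  by rewrite maxEle; case: ifP.
have mle a : eigenvalue M a -> a <= m.
  by rewrite sE => a_s; exact: le_bigmax_seq.
suff -> : largest_eigenvalue M = m by rewrite sE.
apply/le_anti/andP; split.
  by apply: ge_sup; [exists a0 | move=> a /mle].
by apply: ub_le_sup; [exists m => a /mle | rewrite /= sE].
Qed.

End Spectrum.

(* Main.v *)
(* A positive vector [x] with [Q x < mu x] entrywise forces [q < mu]. Applied to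
   the degree vector it bounds [q G] by the maximum over vertices [i] of
   [d i + S i / d i], where [S i] is the sum of the degrees of the neighbours of
   [i]. If [G] is C4-free and bicyclic, two vertices have at most one common
   neighbour, and at most two triangles pass through [i]: a spanning tree
   contains all edges at [i], hence none of the edges inside the neighbourhood
   of [i], and leaves only two edges. So [S i <= min (d i + n - 1) (n + 3)], and
   if all degrees are at most [n - 3] this gives [q G <= n - 1] (or [<= 36/5]
   if [n = 8]), which is less than [q (G6 n)]. If some degree is at least
   [n - 2], the same counting leaves only G4, G5 and G6. These three are
   compared through the polynomials whose roots are their main eigenvalues. *)

Require Import Defs.
From mathcomp Require Import all_boot all_order all_algebra.
From mathcomp Require Import all_classical all_reals.
From mathcomp Require Import ring lra zify.
Set Implicit Arguments.
Unset Strict Implicit.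
Unset Printing Implicit Defensive.
Import Order.TTheory GRing.Theory Num.Theory.
Local Open Scope ring_scope.

(** * Bounds on the largest signless Laplacian eigenvalue *)

Section SpectralBounds.
Variables (R : realType) (n : nat) (G : sgraph n).
Implicit Types (x v : 'I_n -> R) (a mu : R).

(** Rows of D + A become sums over incident edges, the matrix-free form in which all later bounds
    are stated. *)
Lemma sum_signless_laplacian v i :
  \sum_j v j * signless_laplacian R G j i = \sum_(j | G i j) (v i + v j).
Proof.
have Hd : \sum_j v j * degmx R G j i = \sum_(j | G i j) v i.
  rewrite (bigD1 i) //= big1 ?addr0; last first.
    by move=> j ji; rewrite !mxE (negbTE ji) mulr0n mulr0.
  by rewrite !mxE eqxx mulr1n sumr_const mulr_natr /deg cardsE.
rewrite big_split /= -Hd [X in _ = _ + X]big_mkcond /= -big_split /=.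
apply: eq_bigr => j _; rewrite mxE mulrDr; congr (_ + _).
by rewrite mxE adj_sym; case: (G i j); rewrite ?mulr1 ?mulr0.
Qed.

Lemma le_q v a i0 : v i0 != 0 ->
  (forall i, \sum_(j | G i j) (v i + v j) = a * v i) -> a <= q R G.
Proof.
move=> v0 Hv; have n0 : (0 < n)%N by case: n i0 {v0 Hv} => [[]|].
have [_] := largest_eigenvalueP n0 (signless_laplacian_sym R G); apply.
apply/eigenvalueP; exists (\row_i v i).
  apply/rowP => i; rewrite !mxE -Hv -sum_signless_laplacian.
  by apply: eq_bigr => j _; rewrite mxE.
by apply/eqP => /rowP/(_ i0); rewrite !mxE; apply/eqP.
Qed.

(* The eigenvector is compared with [x] at an index where their ratio is
   extremal. *)
Lemma q_lt x mu : (0 < n)%N -> (forall i, 0 < x i) ->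
  (forall i, \sum_(j | G i j) (x i + x j) < mu * x i) -> q R G < mu.
Proof.
move=> n0 x0 Hx.
have [] := largest_eigenvalueP n0 (signless_laplacian_sym R G).
rewrite -/(q R G); set a := q R G => /eigenvalueP [w wQ w0] _.
pose v i := w 0 i.
have Hv i : \sum_(j | G i j) (v i + v j) = a * v i.
  by rewrite -sum_signless_laplacian; move/rowP/(_ i): wQ; rewrite !mxE.
have [k vk] : exists k, v k != 0 by apply/rV0Pn.
case: (@arg_maxP _ R _ k predT (fun i => `|v i| / x i) isT) => i _ Hi.
have c0 : 0 < `|v i| / x i.
  by apply: lt_le_trans (Hi k isT); rewrite divr_gt0 ?normr_gt0.
have vle j : `|v j| <= `|v i| / x i * x j.
  by rewrite -ler_pdivrMr //; apply: Hi.
have vi0 : 0 < `|v i| by rewrite -(pmulr_lgt0 _ (x := (x i)^-1)) ?invr_gt0.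
apply: le_lt_trans (ler_norm a) _.
rewrite -(ltr_pM2r vi0) -normrM -Hv.
apply: le_lt_trans (ler_norm_sum _ _ _) _.
have -> : mu * `|v i| = `|v i| / x i * (mu * x i).
  by field; rewrite gt_eqF.
apply: le_lt_trans (_ : _ <= `|v i| / x i * \sum_(j | G i j) (x i + x j)) _.
  rewrite mulr_sumr ler_sum // => j _.
  by rewrite mulrDr; apply: le_trans (ler_normD _ _) _; rewrite lerD.
by rewrite ltr_pM2l.
Qed.

End SpectralBounds.
(** * The signless Laplacians of G4, G5 and G6 *)

Section Rows.
Variables (R : realType) (m : nat).
Implicit Types (x : nat -> R) (P : R -> R -> Prop).

(** Contribution of vertex j to row i of D + A applied to [x]; indices in [nat] let it compute at
    concrete labels. *)
Definition term (E : rel nat) x (i j : nat) : R :=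
  if (i != j) && (E i j || E j i) then x i + x j else 0.

Lemma sum_mkgraph n E x (i : 'I_n) :
  \sum_(j | mkgraph n E i j) (x i + x j) = \sum_(j < n) term E x i j.
Proof. by rewrite big_mkcond. Qed.

Lemma big_ord_add5 n (F : nat -> R) : \sum_(j < n.+4.+1) F j =
  F 0%N + F 1%N + F 2%N + F 3%N + F 4%N + \sum_(j < n) F j.+4.+1.
Proof. by rewrite !big_ord_recl /= !addrA. Qed.

(* Vertices 0, ..., 4 carry [w], [a], [b], [t], [s], the last two vertices
   carry [c] and [z], and the others [p]. *)
Definition vec (w a b t s p c z : R) (i : nat) : R :=
  match i with
  | 0 => w | 1 => a | 2 => b | 3 => t | 4 => s
  | k.+4.+1 => if (k == m.+2)%N then z else if (k == m.+1)%N then c else p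
  end.

Lemma vec_gt0 w a b t s p c z i :
  0 < w -> 0 < a -> 0 < b -> 0 < t -> 0 < s -> 0 < p -> 0 < c -> 0 < z ->
  0 < vec w a b t s p c z i.
Proof. by move: i => [|[|[|[|[|k]]]]] //= *; do 2?case: ifP. Qed.

Local Notation n := (m.+4.+4).

Lemma sum_split (F : nat -> R) :
  (forall k, (k <= m)%N -> F k.+4.+1 = F 5%N) ->
  \sum_(j < n) F j = F 0%N + F 1%N + F 2%N + F 3%N + F 4%N
    + (m.+1)%:R * F 5%N + F m.+2.+4 + F m.+3.+4.
Proof.
move=> HF; rewrite (@big_ord_add5 m.+3) 2!big_ord_recr /= !addrA.
rewrite (eq_bigr (fun=> F 5%N)); last by move=> k _; apply: HF; rewrite -ltnS.
by rewrite sumr_const card_ord mulr_natl.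
Qed.

Lemma ord_ind8 (T : nat -> Prop) :
  T 0%N -> T 1%N -> T 2%N -> T 3%N -> T 4%N ->
  (forall k, (k <= m)%N -> T k.+4.+1) -> T m.+2.+4 -> T m.+3.+4 ->
  forall i : 'I_n, T i.
Proof.
move=> T0 T1 T2 T3 T4 Tk T6 T7 [[|[|[|[|[|k]]]]] ik] //=.
have [|mk] := leqP k m; first exact: Tk.
have [->//|k1] := eqVneq k m.+1.
suff -> : k = m.+2 by [].
by move: ik mk k1; lia.
Qed.

(** [P] relates a row sum to its entry, so that one computation serves both eigenvector equations
    and the strict inequalities of [q_lt]. The vertices 5, ..., m + 5 contribute equally to every
    row, hence the factor m + 1. *)
Lemma sum_mkgraph_split E x P :
  let S i := term E x i 0 + term E x i 1 + term E x i 2 + term E x i 3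
     + term E x i 4 + (m.+1)%:R * term E x i 5 + term E x i m.+2.+4
     + term E x i m.+3.+4 in
  (forall i k, (k <= m)%N -> term E x i k.+4.+1 = term E x i 5) ->
  P (S 0%N) (x 0%N) -> P (S 1%N) (x 1%N) -> P (S 2%N) (x 2%N) ->
  P (S 3%N) (x 3%N) -> P (S 4%N) (x 4%N) ->
  (forall k, (k <= m)%N -> P (S k.+4.+1) (x k.+4.+1)) ->
  P (S m.+2.+4) (x m.+2.+4) -> P (S m.+3.+4) (x m.+3.+4) ->
  forall i : 'I_n, P (\sum_(j | mkgraph n E i j) (x i + x j)) (x i).
Proof.
move=> S HE P0 P1 P2 P3 P4 P5 P6 P7 i.
rewrite sum_mkgraph sum_split -/(S i); last exact: HE.
exact: (@ord_ind8 (fun k => P (S k) (x k))).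
Qed.

Let m1 : ((m == m.+1) = false) * ((m.+1 == m) = false) * ((m == m.+2) = false)
  * ((m.+1 == m.+2) = false) * ((m.+2 == m.+1) = false) * ((m.+2 == m) = false).
Proof. by do 5?split; lia. Qed.

Let k1 k : (k <= m)%N ->
  ((k == m.+1) = false) * ((m.+1 == k) = false)
  * ((k == m.+2) = false) * ((m.+2 == k) = false).
Proof. by move=> km; do 3?split; lia. Qed.

Ltac row :=
  rewrite /term /= ?inE ?xpair_eqE /= ?ltnS ?ltnn ?leqnn ?eqSS ?eqxx ?m1 /=;
  rewrite ?orbT ?andbF; try ring.

Lemma rows_G6 w a b t s p c z P :
  P (m.+2.+4%:R * w + a + b + t + s + m.+1%:R * p + c) w ->
  P (2 * a + w + b) a -> P (2 * b + w + a) b ->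
  P (2 * t + w + s) t -> P (2 * s + w + t) s ->
  P (p + w) p -> P (2 * c + w + z) c -> P (z + c) z ->
  let x := vec w a b t s p c z in
  forall i : 'I_n, P (\sum_(j | G6 n i j) (x i + x j)) (x i).
Proof.
have eP u u' y : P u y -> u = u' -> P u' y by move=> ? <-.
move=> P0 Pa Pb Pt Ps Pp Pc Pz x; rewrite /x /G6; apply: sum_mkgraph_split.
- move=> i k km; rewrite /term /= !inE !xpair_eqE !eqSS !ltnS !(k1 km).
  rewrite ?(leq_trans km) // !andbF !orbF.
  by case: i => [|[|[|[|[|?]]]]]; rewrite /= ?andbF.
- by apply: eP P0 _; row.
- by apply: eP Pa _; row.
- by apply: eP Pb _; row.
- by apply: eP Pt _; row.
- by apply: eP Ps _; row.
- move=> k km /=; rewrite !(k1 km); apply: eP Pp _.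
  by rewrite /term /= ?inE ?xpair_eqE /= ?eqSS ?(k1 km) ?ltnS ?(leqW km); row.
- by rewrite /= !eqxx m1; apply: eP Pc _; row.
- by rewrite /= ?eqxx; apply: eP Pz _; row.
Qed.

(** Vertex n - 2 is pendant at the centre here, hence [p] in the place of [c] and m + 2 such
    entries. *)
Lemma rows_G5 w a b t s p z P :
  P (m.+2.+4%:R * w + a + b + t + s + m.+2%:R * p) w ->
  P (3 * a + w + b + z) a -> P (2 * b + w + a) b ->
  P (2 * t + w + s) t -> P (2 * s + w + t) s ->
  P (p + w) p -> P (z + a) z ->
  let x := vec w a b t s p p z in
  forall i : 'I_n, P (\sum_(j | G5 n i j) (x i + x j)) (x i).
Proof.
have eP u u' y : P u y -> u = u' -> P u' y by move=> ? <-.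
move=> P0 Pa Pb Pt Ps Pp Pz x; rewrite /x /G5; apply: sum_mkgraph_split.
- move=> i k km; rewrite /term /= !inE !xpair_eqE !eqSS !ltnS !(k1 km).
  rewrite ?(leq_trans km) // !andbF !orbF.
  by case: i => [|[|[|[|[|?]]]]]; rewrite /= ?andbF.
- by apply: eP P0 _; row.
- by apply: eP Pa _; row.
- by apply: eP Pb _; row.
- by apply: eP Pt _; row.
- by apply: eP Ps _; row.
- move=> k km /=; rewrite !(k1 km); apply: eP Pp _.
  by rewrite /term /= ?inE ?xpair_eqE /= ?eqSS ?(k1 km) ?ltnS ?(leqW km); row.
- by rewrite /= !eqxx m1; apply: eP Pp _; row.
- by rewrite /= ?eqxx; apply: eP Pz _; row.
Qed.

Lemma rows_G4 w t p P :
  P (m.+3.+4%:R * w + 4 * t + m.+3%:R * p) w ->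
  P (3 * t + w) t -> P (p + w) p ->
  let x := vec w t t t t p p p in
  forall i : 'I_n, P (\sum_(j | G4 n i j) (x i + x j)) (x i).
Proof.
have eP u u' y : P u y -> u = u' -> P u' y by move=> ? <-.
move=> P0 Pt Pp x; rewrite /x /G4; apply: sum_mkgraph_split.
- move=> i k km; rewrite /term /= !inE !xpair_eqE !eqSS !(k1 km).
  rewrite !andbF !orbF.
  by case: i => [|[|[|[|[|?]]]]]; rewrite /= ?andbF.
- by apply: eP P0 _; row.
- by apply: eP Pt _; row.
- by apply: eP Pt _; row.
- by apply: eP Pt _; row.
- by apply: eP Pt _; row.
- move=> k km /=; rewrite !(k1 km); apply: eP Pp _.
  by rewrite /term /= ?inE ?xpair_eqE /= ?eqSS ?(k1 km) ?ltnS ?(leqW km); row.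
- by rewrite /= !eqxx m1; apply: eP Pp _; row.
- by rewrite /= ?eqxx; apply: eP Pp _; row.
Qed.

End Rows.

(** * Eigenvalue polynomials of G4, G5, G6 and the order of these graphs *)

Section Roots.
Variables (R : realType) (m : nat).
Local Notation n := (m.+4.+4).
Local Notation N := (m%:R : R).
Implicit Types r : R.

(* For k = 4, 5, 6, a root [r > 3] of [polGk] is an eigenvalue of the signless
   Laplacian of Gk: [polGk] is the row at the centre, after solving the other
   rows for the remaining entries in terms of [r] and clearing denominators. *)
Definition polG4 : {poly R} :=
  ('X - (N + 7)%:P) * ('X - 3%:P) * ('X - 1) - 4%:P * ('X - 1)
  - (N + 3)%:P * ('X - 3%:P).

(** The determinant (X - 2)(X - 1) - 1 of the rows [c], [z] of the pendant path in G6. *)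
Definition polC : {poly R} := 'X ^+ 2 - 3%:P * 'X + 1.

Definition polG6 : {poly R} :=
  (('X - (N + 6)%:P) * ('X - 3%:P) * ('X - 1) - 4%:P * ('X - 1)
   - (N + 1)%:P * ('X - 3%:P)) * polC - ('X - 1) ^+ 2 * ('X - 3%:P).

(** The determinant (X - 3)(X - 2)(X - 1) - (X - 1) - (X - 2) of the rows [a], [b], [z] of G5. *)
Definition polD : {poly R} := 'X ^+ 3 - 6%:P * 'X ^+ 2 + 9%:P * 'X - 3%:P.

Definition polG5 : {poly R} :=
  (('X - (N + 6)%:P) * ('X - 3%:P) * ('X - 1) - 2%:P * ('X - 1)
   - (N + 2)%:P * ('X - 3%:P)) * polD
  - (2%:P * 'X ^+ 2 - 5%:P * 'X + 2%:P) * ('X - 3%:P) * ('X - 1).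

Lemma polG4E r : polG4.[r] =
  (r - (N + 7)) * (r - 3) * (r - 1) - 4 * (r - 1) - (N + 3) * (r - 3).
Proof. by rewrite /polG4 !hornerE. Qed.

Lemma polG6E r : polG6.[r] =
  ((r - (N + 6)) * (r - 3) * (r - 1) - 4 * (r - 1) - (N + 1) * (r - 3))
  * (r ^+ 2 - 3 * r + 1) - (r - 1) ^+ 2 * (r - 3).
Proof. by rewrite /polG6 /polC !hornerE. Qed.

Lemma polG5E r : polG5.[r] =
  ((r - (N + 6)) * (r - 3) * (r - 1) - 2 * (r - 1) - (N + 2) * (r - 3))
  * (r ^+ 3 - 6 * r ^+ 2 + 9 * r - 3)
  - (2 * r ^+ 2 - 5 * r + 2) * (r - 3) * (r - 1).
Proof. by rewrite /polG5 /polD !hornerE. Qed.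

Let N0 : 0 <= N. Proof. exact: ler0n. Qed.
Let N2 : 0 <= N ^+ 2. Proof. exact: exprn_ge0. Qed.
Let N3 : 0 <= N ^+ 3. Proof. exact: exprn_ge0. Qed.
Let N4 : 0 <= N ^+ 4. Proof. exact: exprn_ge0. Qed.
Let N5 : 0 <= N ^+ 5. Proof. exact: exprn_ge0. Qed.
Let nE : n%:R = N + 8 :> R. Proof. ring. Qed.

(** The outer rows force t = w / (r - 3) and p = w / (r - 1); the vector is scaled to clear
    denominators, and the row at the centre is then the root equation. *)
Lemma le_q_G4 r : N + 7 <= r -> root polG4 r -> r <= q R (G4 n).
Proof.
move=> r7 /rootP; rewrite polG4E => Hr.
apply: (@le_q R n _ (fun i => vec m ((r - 3) * (r - 1)) (r - 1) (r - 1)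
  (r - 1) (r - 1) (r - 3) (r - 3) (r - 3) i) r ord0).
  by rewrite /= mulf_neq0 // gt_eqF // subr_gt0; move: N0; lra.
apply: (@rows_G4 R m _ _ _ (fun y z => y = r * z)); try ring.
apply/eqP; rewrite -subr_eq0; apply/eqP.
by rewrite -[RHS]oppr0 -Hr; ring.
Qed.

Lemma le_q_G6 r : N + 7 <= r -> root polG6 r -> r <= q R (G6 n).
Proof.
move=> r7 /rootP; rewrite polG6E => Hr.
pose C := r ^+ 2 - 3 * r + 1.
have C0 : 0 < C by rewrite /C; move: N0 => ?; nra.
pose t := C * (r - 1); pose p := C * (r - 3).
apply: (@le_q R n _ (fun i => vec m (C * (r - 3) * (r - 1)) t t t t p
  ((r - 1) ^+ 2 * (r - 3)) ((r - 3) * (r - 1)) i) r ord0).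
  by rewrite /= !mulf_neq0 // gt_eqF // ?subr_gt0; move: N0; lra.
apply: (@rows_G6 R m _ _ _ _ _ _ _ _ (fun y z => y = r * z));
  rewrite /t /p /C; try ring.
apply/eqP; rewrite -subr_eq0; apply/eqP.
by rewrite -[RHS]oppr0 -Hr; ring.
Qed.

(** The eigenvector for r is positive, so it also serves as test vector in [q_lt]: no eigenvalue
    exceeds r. *)
Lemma q_G6_lt r mu : N + 7 <= r -> root polG6 r -> r < mu -> q R (G6 n) < mu.
Proof.
move=> r7 /rootP; rewrite polG6E => Hr rmu.
pose C := r ^+ 2 - 3 * r + 1.
have C0 : 0 < C by rewrite /C; move: N0 => ?; nra.
have r1 : 0 < r - 1 by move: N0; lra.
have r3 : 0 < r - 3 by move: N0; lra.
pose t := C * (r - 1); pose p := C * (r - 3).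
pose x := vec m (C * (r - 3) * (r - 1)) t t t t p
  ((r - 1) ^+ 2 * (r - 3)) ((r - 3) * (r - 1)).
have x0 i : 0 < x i by apply: vec_gt0; rewrite /t /p ?mulr_gt0 ?exprn_gt0.
have Hx : forall i : 'I_n, \sum_(j | G6 n i j) (x i + x j) = r * x i.
  apply: (@rows_G6 R m _ _ _ _ _ _ _ _ (fun y z => y = r * z));
    rewrite /t /p /C; try ring.
  apply/eqP; rewrite -subr_eq0; apply/eqP.
  by rewrite -[RHS]oppr0 -Hr; ring.
by apply: (@q_lt R n _ (fun i => x i)) => // i; rewrite Hx ltr_pM2r.
Qed.

Lemma le_q_G5 r : N + 7 <= r -> root polG5 r -> r <= q R (G5 n).
Proof.
move=> r7 /rootP; rewrite polG5E => Hr.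
pose D := r ^+ 3 - 6 * r ^+ 2 + 9 * r - 3.
have r0 : 0 <= r - 7 by move: N0; lra.
(* With s = r - 7, D = s^3 + 15 s^2 + 72 s + 109. *)
have D0 : 0 < D by rewrite /D; move: (exprn_ge0 2 r0) (exprn_ge0 3 r0); lra.
pose e := (r - 3) * (r - 1).
apply: (@le_q R n _ (fun i => vec m (D * e) ((r - 1) ^+ 2 * e)
  ((r ^+ 2 - 3 * r + 1) * e) (D * (r - 1)) (D * (r - 1)) (D * (r - 3))
  (D * (r - 3)) ((r - 1) * e) i) r ord0).
  by rewrite /= !mulf_neq0 // gt_eqF // ?subr_gt0; move: N0; lra.
apply: (@rows_G5 R m _ _ _ _ _ _ _ (fun y z => y = r * z));
  rewrite /D /e; try ring.
apply/eqP; rewrite -subr_eq0; apply/eqP.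
by rewrite -[RHS]oppr0 -Hr; ring.
Qed.

(** [polG4] takes the value -8 at n and is nonnegative at 2n, so it has a root in between. *)
Lemma q_G4_ge : n%:R <= q R (G4 n).
Proof.
have ab : n%:R <= 2 * n%:R :> R by rewrite nE; move: N0; lra.
have [|r /andP[r1 _] rr] := @poly_ivt R polG4 _ _ ab.
  rewrite !polG4E nE; apply/andP; split.
    by lra.
  by move: N0 N2 N3; lra.
by apply: le_trans (le_q_G4 _ rr) => //; move: r1; rewrite nE; lra.
Qed.

(** The test vector is the degree vector of G5. Together with [q_G4_ge], n separates G5 from G4. *)
Lemma q_G5_lt : q R (G5 n) < n%:R.
Proof.
apply: (@q_lt R n _ (fun i => vec m (N + 6) 3 2 2 2 1 1 1 i)) => // [i|].
  by apply: vec_gt0 => //; move: N0; lra.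
have e6 : m.+2.+4%:R = N + 6 by ring.
have e2 : m.+2%:R = N + 2 by ring.
apply: (@rows_G5 R m _ _ _ _ _ _ _ (fun y z => y < n%:R * z)).
all: by rewrite nE ?e6 ?e2; move: N0 N2; lra.
Qed.

(* [polD * polG6 - polC * polG5] has positive coefficients in [r - 7]. *)
Lemma polG6_gt0 r : N + 7 <= r -> root polG5 r -> 0 < polG6.[r].
Proof.
move=> r7 /rootP; rewrite polG5E polG6E => Hr.
pose D := r ^+ 3 - 6 * r ^+ 2 + 9 * r - 3.
have r0 : 0 <= r - 7 by move: N0; lra.
have D0 : 0 < D by rewrite /D; move: (exprn_ge0 2 r0) (exprn_ge0 3 r0); lra.
(* At a root of [polG5] the subtracted product vanishes, so the sign of the difference is that of
   [polG6]; N cancels in the difference. *)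
rewrite -(pmulr_rgt0 _ D0) -[X in _ < X]subr0.
rewrite -[X in _ < _ - X](mulr0 (r ^+ 2 - 3 * r + 1)) -Hr /D.
move: r0 (exprn_ge0 2 r0) (exprn_ge0 3 r0) (exprn_ge0 4 r0).
by lra.
Qed.

(** The value is -9 N^2 - 99 N - 260. *)
Lemma polG6_pred_lt0 : polG6.[N + 7] < 0.
Proof.
by rewrite polG6E; move: N0 N2; lra.
Qed.

Lemma root_lt (P : {poly R}) a b : a <= b -> P.[a] < 0 -> 0 < P.[b] ->
  exists2 r, a < r < b & root P r.
Proof.
move=> ab Pa Pb; have [|r /andP[ar rb] rr] := @poly_ivt R P _ _ ab.
  by rewrite !ltW.
exists r => //; rewrite !lt_neqAle ar rb !andbT; apply/andP; split.
  by apply: contraTneq Pa => ->; rewrite (rootP rr) ltxx.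
by apply: contraTneq Pb => <-; rewrite (rootP rr) ltxx.
Qed.

(** [polG5] has a root r5 between n - 1 and n. As [polG6] is negative at n - 1 and positive at r5,
    it has a root below r5, and r5 separates the two eigenvalues. *)
Lemma q_G6_lt_G5 : q R (G6 n) < q R (G5 n).
Proof.
have ab : N + 7 <= N + 8 by lra.
have [||r5 /andP[r57 _] rr5] := @root_lt polG5 _ _ ab.
- by rewrite polG5E; move: N0 N2 N3; lra.
- by rewrite polG5E; move: N0 N2 N3 N4 N5; lra.
have [||r6 /andP[r67 r65] rr6] := @root_lt polG6 _ _ (ltW r57).
- exact: polG6_pred_lt0.
- exact: polG6_gt0 (ltW r57) rr5.
exact: lt_le_trans (q_G6_lt (ltW r67) rr6 r65) (le_q_G5 (ltW r57) rr5).
Qed.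

(** [polG6] is positive at n, so a negative value at mu leaves a root above mu. *)
Lemma q_G6_gt mu : N + 7 <= mu <= N + 8 -> polG6.[mu] < 0 -> mu < q R (G6 n).
Proof.
move=> /andP[mu7 mu8] Hmu; have [|r /andP[mr _] rr] := root_lt mu8 Hmu.
  by rewrite polG6E; move: N0 N2 N3 N4; lra.
exact: lt_le_trans mr (le_q_G6 (le_trans mu7 (ltW mr)) rr).
Qed.

Lemma q_G6_gt_pred : N + 7 < q R (G6 n).
Proof. by apply: q_G6_gt polG6_pred_lt0; lra. Qed.

End Roots.

(** For n = 8 a vertex of degree 5 only gives the bound 5 + 11/5 = 36/5, which exceeds n - 1. *)
Lemma q_G6_8_gt (R : realType) : 36 / 5 < q R (G6 8).
Proof.
by apply: (@q_G6_gt R 0); rewrite ?polG6E; lra.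
Qed.
(** * Counting in C4-free bicyclic graphs *)

Section Combinatorics.
Local Open Scope set_scope.
Local Open Scope nat_scope.
Variables (n : nat) (G : sgraph n).

Definition nbr (i : 'I_n) : {set 'I_n} := [set j | G i j].

(** The (i, k) entry of the squared adjacency matrix. *)
Definition codeg (i k : 'I_n) : nat := #|[set j | G i j && G j k]|.

(* The edges opposite to [w] in the triangles through [w]. *)
Definition link (w : 'I_n) : {set {set 'I_n}} :=
  [set e in edges G | e \subset nbr w].

Lemma edges_mem u v : G u v -> [set u; v] \in edges G.
Proof. by move=> uv; apply/imsetP; exists (u, v); rewrite ?inE. Qed.

Lemma edgesP e : e \in edges G -> exists u v, e = [set u; v] /\ G u v.
Proof. by case/imsetP => -[u v]; rewrite inE /= => uv ->; exists u, v. Qed.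

Lemma adj_neq u v : G u v -> u != v.
Proof. by apply: contraTneq => ->; rewrite adj_irrefl. Qed.

(** Two distinct common neighbours of u and v would close the 4-cycle u, x, v, y. *)
Lemma C4_free_uniq u v x y : C4_free G -> u != v ->
  G u x -> G x v -> G u y -> G y v -> x = y.
Proof.
move=> C4G uv ux xv uy yv; apply/eqP; apply/negPn/negP => xy; apply: C4G.
have [uNx xNv uNy yNv] :=
  And4 (adj_neq ux) (adj_neq xv) (adj_neq uy) (adj_neq yv).
exists (tnth [tuple u; x; v; y]); split.
  apply/injectiveP; rewrite /injectiveb /dinjectiveb.
  rewrite (_ : [seq _ | _ <- _] = [:: u; x; v; y]).
    by rewrite /= !inE !negb_or uNx uv uNy xNv xy (eq_sym v) yNv.
  by rewrite enumT -[RHS](map_tnth_enum [tuple u; x; v; y]) enumT.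
move=> i j; rewrite /= /mkadj !(tnth_nth u).
by case: i j => -[|[|[|[|//]]]] ? [[|[|[|[|//]]]] ?] //= _; rewrite // adj_sym.
Qed.

Lemma codeg_le1 i k : C4_free G -> i != k -> codeg i k <= 1.
Proof.
move=> C4G ik; apply/card_le1_eqP => x y; rewrite !inE.
by move=> /andP[ix xk] /andP[iy yk]; exact: (C4_free_uniq C4G ik).
Qed.

Lemma codeg_diag i : codeg i i = deg G i.
Proof.
by apply: eq_card => j; rewrite !inE [G j i]adj_sym andbb.
Qed.

(** Walks of length two from i, counted by middle vertex and by end. *)
Lemma sum_deg_nbr i : \sum_(j | G i j) deg G j = \sum_k codeg i k.
Proof.
under eq_bigr => j _ do rewrite /deg -sum1dep_card big_mkcond.
rewrite exchange_big; apply: eq_bigr => k _.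
by rewrite /codeg -sum1dep_card big_mkcondr.
Qed.

Lemma sum_deg_nbr_le i : C4_free G -> \sum_(j | G i j) deg G j <= deg G i + n.-1.
Proof.
move=> C4G; rewrite sum_deg_nbr (bigD1 i) //= codeg_diag leq_add2l.
apply: leq_trans (_ : \sum_(k | k != i) 1 <= _).
  by apply: leq_sum => k ki; rewrite codeg_le1 // eq_sym.
by rewrite sum1_card cardC1 card_ord.
Qed.

(** * Spanning trees and triangles through a vertex *)

(** A breadth-first tree: [h] is the distance from w and [p k] the vertex before k on a shortest
    walk. *)
Lemma parent_exists (w : 'I_n) : connected G ->
  exists (p : 'I_n -> 'I_n) (h : 'I_n -> nat), forall k, k != w ->
    [/\ G k (p k), h (p k) < h k & G w k -> p k = w].
Proof.
move=> conG.
(* Tuples of fixed length make the existence of a walk of length l decidable, as [ex_minn]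
   requires. *)
pose W k l := [exists t : l.-tuple 'I_n, path G w t && (k == last w t)].
have exW k : exists l, W k l.
  have /connectP[t wt kt] := conG w k.
  by exists (size t); apply/existsP; exists (in_tuple t); rewrite /= wt kt eqxx.
pose h k := ex_minn (exW k).
have hmin k l : W k l -> h k <= l by rewrite /h; case: ex_minnP => l' _; apply.
have hW k : W k (h k) by rewrite /h; case: ex_minnP.
have h0 k : k != w -> 0 < h k.
  move=> kw; rewrite lt0n; apply: contraNneq kw => hk.
  have := hW k; rewrite hk => /existsP[t]; rewrite (tuple0 t) /= => ->.
  by [].
have hw : h w = 0.
  by apply/eqP; rewrite -leqn0 hmin //; apply/existsP; exists [tuple]; rewrite /= eqxx.
suff /fin_all_exists[p Hp] : forall k, exists q, k != w ->
    [/\ G k q, h q < h k & G w k -> q = w] by exists p, h.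
move=> k; case: (boolP (G w k)) => wk.
  by exists w => kw; rewrite adj_sym wk hw h0.
case: (eqVneq k w) => [->|kw]; first by exists w.
have := hW k; case E: (h k) (h0 k kw) => [//|l] _ /existsP[t].
case/andP; have := size_tuple t; case/lastP: (tval t) => [//|s x].
rewrite size_rcons rcons_path last_rcons => -[sl] /andP[ws sx] /eqP kx.
exists (last w s) => _; split; first by rewrite kx adj_sym.
  rewrite ltnS hmin //; apply/existsP.
  have sP : size s == l by rewrite sl.
  by exists (Tuple sP); rewrite /= ws eqxx.
by [].
Qed.

(* The edges [{k, p k}], with [p k] nearer to [w] than [k], form a spanning tree. *)
Lemma spanning_edges (w : 'I_n) : connected G ->
  exists p : 'I_n -> 'I_n,
  let S := [set [set k; p k] | k in [set~ w]] in
  [/\ forall k, k != w -> G k (p k), forall k, G w k -> p k = w,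
     S \subset edges G, #|S| = n.-1 & [disjoint S & link w]].
Proof.
move=> conG; have [p [h ph]] := parent_exists w conG; exists p => /=.
have pw k : G w k -> p k = w.
  by move=> wk; have [|_ _] := ph k; [rewrite eq_sym adj_neq | apply].
split=> //.
- by move=> k /ph[].
- apply/fintype.subsetP => e /imsetP[k]; rewrite !inE => /ph[kp _ _] ->.
  exact: edges_mem.
(* If k and k' differ but give the same edge, each is the parent of the other, against the decrease
   of [h]. *)
- rewrite card_in_imset ?cardsC1 ?card_ord // => k k'; rewrite !inE.
  move=> /ph[_ hk _] /ph[_ hk' _] E; apply/eqP; apply: contraLR hk => kk'.
  have : k \in [set k'; p k'] by rewrite -E set21.
  rewrite in_set2 (negbTE kk') /= => /eqP kpk.
  have : k' \in [set k; p k] by rewrite E set21.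
  rewrite in_set2 eq_sym (negbTE kk') /= => /eqP <-.
  by rewrite {1}kpk -leqNgt ltnW // kpk.
(* An edge of the link has both ends adjacent to w, but then the parent of either end is w
   itself. *)
- rewrite -setI_eq0; apply/eqP/setP => e; rewrite !inE.
  apply/negP => /andP[/imsetP[k _ ->] /andP[_]].
  rewrite finset.subUset !finset.sub1set !inE => /andP[wk].
  by rewrite pw // adj_irrefl.
Qed.

(** The n - 1 tree edges avoid the link, and there are n + 1 edges in all. *)
Lemma card_link_le2 w : bicyclic G -> #|link w| <= 2.
Proof.
move=> [conG eG]; have [p /= [_ _ Se Sn dis]] := spanning_edges w conG.
have n0 : 0 < n by case: n w {p Se Sn dis} => [[]|].
have : #|[set [set k; p k] | k in [set~ w]] :|: link w| <= n.+1.
  rewrite -eG subset_leq_card // finset.subUset Se /=.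
  by apply/fintype.subsetP => e; rewrite inE => /andP[].
rewrite cardsU disjoint_setI0 // cards0 subn0 Sn.
by move: #|link w| => l; move: n0; lia.
Qed.

(** If every vertex outside the closed neighbourhood of w has at most one neighbour, every edge is a
    tree edge or in the link, so the count is exact. *)
Lemma card_link_eq2 w : bicyclic G ->
  (forall k j j', k != w -> ~~ G w k -> G k j -> G k j' -> j = j') ->
  #|link w| = 2.
Proof.
move=> [conG eG] pend; have [p /= [pG pw Se Sn dis]] := spanning_edges w conG.
have n0 : 0 < n by case: n w {p pG pw Se Sn dis pend} => [[]|].
have : edges G = [set [set k; p k] | k in [set~ w]] :|: link w.
  apply/eqP; rewrite finset.eqEsubset finset.subUset Se /=; apply/andP; split; last first.
    by apply/fintype.subsetP => e; rewrite inE => /andP[].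
  apply/fintype.subsetP => e eG'; have [u [v [E uv]]] := edgesP eG'.
  (* Under these conditions y is the parent of x, so the edge lies in the tree. *)
  have par x y : e = [set x; y] -> G x y -> x != w -> (G w x -> y = w) ->
      e \in [set [set k; p k] | k in [set~ w]] :|: link w.
    move=> -> xy xw xyw; rewrite inE; apply/orP; left; apply/imsetP.
    exists x; first by rewrite !inE.
    case: (boolP (G w x)) => wx; first by rewrite pw // xyw.
    by rewrite (pend x y (p x)) // pG.
  have E' : e = [set v; u] by rewrite finset.setUC.
  have vu : G v u by rewrite adj_sym.
  have [uw|uw] := eqVneq u w.
    by apply: (par v u) => //; rewrite -uw eq_sym adj_neq.
  have [vw|vw] := eqVneq v w; first exact: (par u v).
  case: (boolP (G w u)) => wu; last by apply: (par u v) => //; rewrite (negbTE wu).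
  case: (boolP (G w v)) => wv; last by apply: (par v u) => //; rewrite (negbTE wv).
  by rewrite inE [_ \in link w]inE eG' E finset.subUset !finset.sub1set !inE wu wv orbT.
move=> /(congr1 (fun A : {set {set 'I_n}} => #|A|)).
rewrite /= eG cardsU disjoint_setI0 // cards0 subn0 Sn.
by move: #|link w| => l; move: n0; lia.
Qed.

Lemma card_cover_link w : bicyclic G -> #|finset.cover (link w)| <= 4.
Proof.
move=> bG; have [+ _] := leq_card_cover (link w); move=> /leq_trans; apply.
apply: leq_trans (_ : \sum_(e in link w) 2 <= _).
  apply: leq_sum => e; rewrite inE => /andP[/edgesP[u [v [-> _]]] _].
  by rewrite cards2; case: (_ != _).
by rewrite sum_nat_const; have := card_link_le2 w bG; lia.
Qed.

(** In the sum of codegrees, k = i gives d = [deg G i], the neighbours in a triangle with i give at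
    most 4, the other neighbours give 0, and the n - 1 - d remaining vertices give at most 1
    each. *)
Lemma sum_deg_nbr_le_add3 i : B G -> \sum_(j | G i j) deg G j <= n + 3.
Proof.
move=> [C4G bG]; rewrite sum_deg_nbr (bigD1 i) //= codeg_diag.
rewrite (bigID (mem (nbr i))) /=.
have le1 : \sum_(k | (k != i) && (k \in nbr i)) codeg i k <= 4.
  apply: leq_trans (card_cover_link i bG).
  rewrite -sum1_card big_mkcond [X in _ <= X]big_mkcond /=.
  apply: leq_sum => k _; case: ifP => // /andP[ki ik].
  have c1 : codeg i k <= 1 by rewrite codeg_le1 // eq_sym.
  case: ifPn => // kc; rewrite leqn0 cards_eq0; apply/eqP/setP => j.
  rewrite !inE; apply/negP => /andP[ij jk]; move/negP: kc; apply.
  apply/bigcupP; exists [set j; k]; last by rewrite set22.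
  rewrite inE edges_mem //= finset.subUset !finset.sub1set !inE ij.
  by rewrite inE in ik.
have le2 : \sum_(k | (k != i) && (k \notin nbr i)) codeg i k + deg G i <= n.-1.
  apply: leq_trans (_ : \sum_(k | (k != i) && (k \notin nbr i)) 1 +
     \sum_(k | (k != i) && (k \in nbr i)) 1 <= _).
    apply: leq_add.
      by apply: leq_sum => k /andP[ki _]; rewrite codeg_le1 // eq_sym.
    rewrite sum1dep_card /deg subset_leq_card //; apply/fintype.subsetP => k.
    by rewrite !inE => ik; rewrite ik eq_sym adj_neq.
  by rewrite addnC -bigID /= sum1_card cardC1 card_ord.
have n0 : 0 < n by case: n i {le1 le2} => [[]|].
apply: leq_trans (leq_add (leqnn _) (leq_add le1 (leqnn _))) _.
move: le2 n0; move: (bigop _ _ _) (deg G i) => s d; lia.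
Qed.

End Combinatorics.
(** * Graphs with a vertex of degree at least n - 2 *)

Section Structure.
Local Open Scope set_scope.
Local Open Scope nat_scope.
Variables (n : nat) (G : sgraph n).

(** The neighbourhood of w induces exactly the two disjoint edges a1 a2 and b1 b2. *)
Definition two_triangles w a1 a2 b1 b2 : Prop :=
  [/\ uniq [:: w; a1; a2; b1; b2], all (G w) [:: a1; a2; b1; b2]
    & forall u v, G w u -> G w v -> G u v =
        [|| (u == a1) && (v == a2), (u == a2) && (v == a1),
            (u == b1) && (v == b2) | (u == b2) && (v == b1)]].

Lemma two_trianglesC w a1 a2 b1 b2 :
  two_triangles w a1 a2 b1 b2 -> two_triangles w b1 b2 a1 a2.
Proof.
case=> U N E; split.
- by rewrite -(perm_uniq (_ : perm_eq [:: w; a1; a2; b1; b2] _)) // perm_cons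
    (perm_catC [:: a1; a2] [:: b1; b2]).
- by move: N => /= /and5P[-> -> -> -> _].
- by move=> u v wu wv; rewrite E //; do 8?case: (_ == _).
Qed.

Lemma two_triangles_swap w a1 a2 b1 b2 :
  two_triangles w a1 a2 b1 b2 -> two_triangles w a2 a1 b1 b2.
Proof.
case=> U N E; split.
- by rewrite -(perm_uniq (_ : perm_eq [:: w; a1; a2; b1; b2] _)) // perm_cons
    (perm_catCA [:: a1] [:: a2] [:: b1; b2]).
- by move: N => /= /and5P[-> -> -> -> _].
- by move=> u v wu wv; rewrite E //; do 8?case: (_ == _).
Qed.

(** The two edges of the link are disjoint: a shared end would have two common neighbours with w. *)
Lemma two_triangles_exist w : C4_free G -> #|link G w| = 2 ->
  exists a1 a2 b1 b2, two_triangles w a1 a2 b1 b2.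
Proof.
move=> C4G /eqP/cards2P[e [f [ef linkE]]].
have linkP e' : e' \in link G w ->
    exists x y, [/\ e' = [set x; y], G x y, G w x & G w y].
  rewrite inE => /andP[/edgesP[x [y [-> xy]]]].
  by rewrite finset.subUset !finset.sub1set !inE => /andP[wx wy]; exists x, y.
have [a1 [a2 [Ee a12 wa1 wa2]]] : exists x y, [/\ e = [set x; y], G x y, G w x & G w y].
  by apply: linkP; rewrite linkE set21.
have [b1 [b2 [Ef b12 wb1 wb2]]] : exists x y, [/\ f = [set x; y], G x y, G w x & G w y].
  by apply: linkP; rewrite linkE set22.
have nb x y y' : G w x -> G w y -> G w y' -> G x y -> G x y' -> y = y'.
  move=> wx wy wy' xy xy'; apply: (C4_free_uniq C4G (adj_neq wx)) => //.
    by rewrite adj_sym.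
  by rewrite adj_sym.
have a21 : G a2 a1 by rewrite adj_sym.
have b21 : G b2 b1 by rewrite adj_sym.
move: ef; rewrite Ee Ef => ef.
have H11 : a1 != b1.
  apply: contraNneq ef => E; apply/eqP; congr [set _; _] => //.
  by apply: (nb b1) => //; rewrite -E.
have H12 : a1 != b2.
  apply: contraNneq ef => E; apply/eqP; rewrite finset.setUC; congr [set _; _] => //.
  by apply: (nb b2) => //; rewrite -E.
have H21 : a2 != b1.
  apply: contraNneq ef => E; apply/eqP; rewrite finset.setUC; congr [set _; _] => //.
  by apply: (nb b1) => //; rewrite -E.
have H22 : a2 != b2.
  apply: contraNneq ef => E; apply/eqP; congr [set _; _] => //.
  by apply: (nb b2) => //; rewrite -E.
exists a1, a2, b1, b2; split.
- rewrite /= !inE !negb_or H11 H12 H21 H22 !(adj_neq wa1) !(adj_neq wa2).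
  by rewrite !(adj_neq wb1) !(adj_neq wb2) !(adj_neq a12) !(adj_neq b12).
- by rewrite /= wa1 wa2 wb1 wb2.
move=> u v wu wv; apply/idP/idP => [uv|]; last first.
  by case/or4P => /andP[/eqP-> /eqP->].
have : [set u; v] \in link G w.
  by rewrite inE edges_mem //= finset.subUset !finset.sub1set !inE wu wv.
rewrite linkE Ee Ef !inE => /orP[]/eqP E.
  have : u \in [set a1; a2] by rewrite -E set21.
  rewrite !inE => /orP[]/eqP Eu; rewrite Eu in uv wu *.
    by rewrite (nb a1 v a2) // !eqxx.
  by rewrite (nb a2 v a1) // !eqxx orbT.
have : u \in [set b1; b2] by rewrite -E set21.
rewrite !inE => /orP[]/eqP Eu; rewrite Eu in uv wu *.
  by rewrite (nb b1 v b2) // !eqxx !orbT.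
by rewrite (nb b2 v b1) // !eqxx !orbT.
Qed.

(** * Isomorphisms read off vertex enumerations *)

Lemma isomorphic_seq (H : sgraph n) w (s : seq 'I_n) : uniq s -> size s = n ->
  (forall i j : 'I_n, G (nth w s i) (nth w s j) = H i j) -> isomorphic G H.
Proof.
move=> us sn HE.
have sT x : x \in s.
  have : #|s| = #|'I_n| by rewrite card_ord (card_uniqP us).
  by move=> E; have := fintype.subset_cardP E (fintype.subset_predT _) x.
have lt x : index x s < n by rewrite -[X in _ < X]sn index_mem.
exists (fun x => Ordinal (lt x)); split.
  apply: injF_bij => x y /(congr1 val) /= E.
  by rewrite -(nth_index w (sT x)) E nth_index.
by move=> x y; rewrite -HE /= !nth_index.
Qed.

(** The special vertices of G4, G5, G6 carry the first five and the last labels; the other pendant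
    vertices fill the middle in any order. *)
Lemma uniq_complete (h t : seq 'I_n) : uniq (h ++ t) ->
  exists r, uniq (h ++ r ++ t) /\ size (h ++ r ++ t) = n.
Proof.
move=> ht; pose r := [seq x <- enum 'I_n | x \notin h ++ t]; exists r.
have P : perm_eq (h ++ r ++ t) (enum 'I_n).
  rewrite perm_catCA; apply: uniq_perm; rewrite ?enum_uniq //.
    rewrite cat_uniq ht filter_uniq ?enum_uniq // andbT.
    by apply/hasPn => x xht; rewrite mem_filter xht.
  by move=> x; rewrite mem_cat mem_filter mem_enum andbT orNb.
by rewrite (perm_uniq P) enum_uniq (perm_size P) size_enum_ord.
Qed.

Lemma isomorphic_G4 w a1 a2 b1 b2 : two_triangles w a1 a2 b1 b2 ->
  (forall k, k != w -> G w k) -> isomorphic G (G4 n).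
Proof.
move=> [U N E] wk.
have [|r [us sn]] := @uniq_complete [:: w; a1; a2; b1; b2] [::].
  by rewrite cats0.
apply: (isomorphic_seq us sn (w := w)); set s := _ ++ _ in us sn *.
have GE u v : G u v = if u == w then v != w else if v == w then true else
   [|| (u == a1) && (v == a2), (u == a2) && (v == a1),
            (u == b1) && (v == b2) | (u == b2) && (v == b1)].
  have [->|uw] := eqVneq u w.
    by have [->|/wk//] := eqVneq v w; rewrite adj_irrefl.
  have [->|vw] := eqVneq v w; first by rewrite adj_sym wk.
  by rewrite E // wk.
have n5 : 4 < n by rewrite -sn.
have sE k (i : 'I_n) : k < n -> (nth w s i == nth w s k) = (val i == k).
  by move=> kn; rewrite nth_uniq ?sn.
move=> i j; rewrite GE.
rewrite !(sE 0 _ (leq_trans _ n5), sE 1 _ (leq_trans _ n5),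
  sE 2 _ (leq_trans _ n5), sE 3 _ (leq_trans _ n5), sE 4 _ (leq_trans _ n5)) //.
rewrite /= /mkadj -!val_eqE /= !inE !xpair_eqE.
by case: {sE} i j => [[|[|[|[|[|i]]]]] ?] [[|[|[|[|[|j]]]]] ?]; rewrite //= andbF.
Qed.

(** When z is the only vertex missed by w and c its only neighbour, all adjacencies are
    determined. *)
Lemma adj_pendant w a1 a2 b1 b2 z c u v : two_triangles w a1 a2 b1 b2 ->
  z != w -> ~~ G w z -> (forall k, k != w -> k != z -> G w k) ->
  (forall k, G z k = (k == c)) ->
  G u v = if u == w then (v != w) && (v != z) else if u == z then v == c
    else if v == w then true else if v == z then u == c
    else [|| (u == a1) && (v == a2), (u == a2) && (v == a1),
             (u == b1) && (v == b2) | (u == b2) && (v == b1)].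
Proof.
move=> [_ _ E] zw wz wk zc.
have [->|uw] := eqVneq u w.
  have [->|vw] := eqVneq v w; first by rewrite adj_irrefl.
  have [->|vz] := eqVneq v z; first exact: negbTE.
  by rewrite wk.
have [->|uz] := eqVneq u z; first exact: zc.
have [->|vw] := eqVneq v w; first by rewrite adj_sym wk.
have [->|vz] := eqVneq v z; first by rewrite adj_sym zc.
by rewrite E // wk.
Qed.

Lemma isomorphic_G5 w a1 a2 b1 b2 z : two_triangles w a1 a2 b1 b2 ->
  z != w -> ~~ G w z -> (forall k, k != w -> k != z -> G w k) ->
  (forall k, G z k = (k == a1)) -> isomorphic G (G5 n).
Proof.
move=> T zw wz wk zc; have [U N _] := T.
have [|r [us sn]] := @uniq_complete [:: w; a1; a2; b1; b2] [:: z].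
  rewrite cat_uniq U /= orbF andbT !inE negb_or zw /=.
  move: N => /= /and5P[wa1 wa2 wb1 wb2 _].
  by rewrite !negb_or; apply/and4P; split; apply: contraNneq wz => ->.
apply: (isomorphic_seq us sn (w := w)); set s := _ ++ _ in us sn *.
have [n' en] : exists n', n = n'.+4.+2.
  by exists (size r); rewrite -[LHS]sn /= size_cat addn1.
have Hz : z = nth w s n.-1.
  by rewrite -[in n.-1]sn nth_last /s !last_cat.
have sE k (i : 'I_n) : k < n -> (nth w s i == nth w s k) = (val i == k).
  by move=> kn; rewrite nth_uniq ?sn.
have n5 k : k < 5 -> k < n by move=> k5; rewrite en (leq_trans k5).
move=> i j; rewrite (adj_pendant _ _ T zw wz wk zc) {}Hz.
rewrite !(sE n.-1, sE 0 _ (n5 _ _), sE 1 _ (n5 _ _), sE 2 _ (n5 _ _),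
  sE 3 _ (n5 _ _), sE 4 _ (n5 _ _)) ?{1}en //.
rewrite /= /mkadj -!val_eqE /= !inE !xpair_eqE.
have En : n.-1 = n'.+4.+1 by rewrite en.
have lt (k : 'I_n) : k <= n'.+4.+1 by have := ltn_ord k; rewrite [X in _ < X]en.
move: (nat_of_ord i) (nat_of_ord j) (lt i) (lt j); rewrite En.
by case=> [|[|[|[|[|k]]]]] [|[|[|[|[|l]]]]];
  rewrite /= ?eqSS ?ltnS ?andbF ?orbF ?andbT //= => kn ln;
  rewrite ?ltn_neqAle ?kn ?ln ?andbT //=; do 2?case: eqP.
Qed.

Lemma isomorphic_G6 w a1 a2 b1 b2 z c : two_triangles w a1 a2 b1 b2 ->
  z != w -> ~~ G w z -> (forall k, k != w -> k != z -> G w k) ->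
  (forall k, G z k = (k == c)) -> c \notin [:: a1; a2; b1; b2] ->
  isomorphic G (G6 n).
Proof.
move=> T zw wz wk zc cab; have [U N _] := T.
have zc1 : G z c by rewrite zc.
have cw : c != w by apply: contraNneq wz => <-; rewrite adj_sym.
have zab : z \notin [:: a1; a2; b1; b2].
  move: N => /= /and5P[wa1 wa2 wb1 wb2 _].
  by rewrite !inE !negb_or; apply/and4P; split; apply: contraNneq wz => ->.
have [|r [us sn]] := @uniq_complete [:: w; a1; a2; b1; b2] [:: c; z].
  rewrite cat_uniq U andTb; apply/andP; split; last first.
    by rewrite /= inE andbT eq_sym (adj_neq zc1).
  apply/hasPn => x; rewrite in_cons mem_seq1 => /orP[]/eqP->.
    by rewrite in_cons negb_or cw.
  by rewrite in_cons negb_or zw.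
apply: (isomorphic_seq us sn (w := w)); set s := _ ++ _ in us sn *.
have [n' en] : exists n', n = n'.+4.+3.
  by exists (size r); rewrite -[LHS]sn /= size_cat addn2.
have Hz : z = nth w s n.-1.
  by rewrite -[in n.-1]sn nth_last /s !last_cat.
have Hc : c = nth w s n.-2.
  have -> : n.-2 = size ([:: w; a1; a2; b1; b2] ++ r).
    by rewrite -[LHS](congr1 (fun k => k.-2) sn) /s catA size_cat addn2.
  by rewrite /s catA nth_cat ltnn subnn.
have sE k (i : 'I_n) : k < n -> (nth w s i == nth w s k) = (val i == k).
  by move=> kn; rewrite nth_uniq ?sn.
have n5 k : k < 5 -> k < n by move=> k5; rewrite en (leq_trans k5).
move=> i j; rewrite (adj_pendant _ _ T zw wz wk zc) {}Hz {}Hc.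
rewrite !(sE n.-1, sE n.-2, sE 0 _ (n5 _ _), sE 1 _ (n5 _ _), sE 2 _ (n5 _ _),
  sE 3 _ (n5 _ _), sE 4 _ (n5 _ _)) ?{1}en //.
rewrite /= /mkadj -!val_eqE /= !inE !xpair_eqE.
have En : n.-1 = n'.+4.+2 by rewrite en.
have lt (k : 'I_n) : k <= n'.+4.+2 by have := ltn_ord k; rewrite [X in _ < X]en.
move: (nat_of_ord i) (nat_of_ord j) (lt i) (lt j); rewrite En /=.
case=> [|[|[|[|[|k]]]]] [|[|[|[|[|l]]]]];
  rewrite /= ?eqSS ?ltnS ?andbF ?orbF ?andbT //= => kn ln;
  rewrite ?ltn_neqAle ?kn ?ln ?andbT //= ?if_same //.
- by rewrite -ltnS ltn_neqAle ln andbT.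
- by rewrite -ltnS ltn_neqAle kn andbT.
have N1 : (n'.+1 == n') = false by rewrite gtn_eqF.
have [->|kN] := eqVneq k n'.+1; have [->|lN] := eqVneq l n'.+1;
  rewrite ?eqxx ?N1 ?andbF ?andbT ?orbF //=.
by rewrite kN.
Qed.
(** At most one vertex z is missed by w. Without z the graph is G4; otherwise z has a single
    neighbour c, and G5 or G6 arises according to whether c lies on a triangle. *)
Lemma large_degree_isomorphic w : B G -> n.-2 <= deg G w ->
  [\/ isomorphic G (G4 n), isomorphic G (G5 n) | isomorphic G (G6 n)].
Proof.
move=> [C4G bG] dw; pose Z := [set k | (k != w) && ~~ G w k].
have Z1 : #|Z| <= 1.
  have : #|Z :|: nbr G w| <= n.-1.
    rewrite -[in X in _ <= X](card_ord n) -(cardC1 w) subset_leq_card //.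
    apply/fintype.subsetP => k; rewrite !inE.
    by case/orP => [/andP[]//|wk]; rewrite eq_sym (adj_neq wk).
  have -> : #|Z :|: nbr G w| = #|Z| + deg G w.
    rewrite cardsU (_ : Z :&: nbr G w = finset.set0) ?cards0 ?subn0 //.
    by apply/setP => k; rewrite !inE; case: (G w k); rewrite ?andbF.
  by move: #|Z| dw => ?; lia.
have [Z0|/finset.set0Pn[z zZ]] := eqVneq Z finset.set0.
  have wk k : k != w -> G w k.
    move=> kw; apply: contraT => wk.
    by have := finset.in_set0 k; rewrite -Z0 inE kw wk.
  have [|a1 [a2 [b1 [b2 T]]]] := two_triangles_exist C4G (w := w).
    by apply: card_link_eq2 => // k j j' /wk ->.
  by constructor 1; exact: isomorphic_G4 T wk.
have [zw wz] : z != w /\ ~~ G w z by move: zZ; rewrite inE => /andP.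
have wk k : k != w -> k != z -> G w k.
  move=> kw kz; apply: contraT => wk; case/negP: kz; apply/eqP.
  by apply: (card_le1_eqP Z1) => //; rewrite inE kw wk.
have [p /= [pG _ _ _ _]] := spanning_edges w bG.1.
pose c := p z; have zc : G z c by exact: pG.
have nbz k : G z k -> G w k.
  move=> zk; apply: wk; last by rewrite eq_sym (adj_neq zk).
  by apply: contraNneq wz => <-; rewrite adj_sym.
have zE k : G z k = (k == c).
  (* All neighbours of z are adjacent to w, so two of them would be two common neighbours of w and
     z. *)
  apply/idP/eqP => [zk|-> //].
  apply: (C4_free_uniq C4G (_ : w != z)); rewrite 1?eq_sym // ?nbz //.
    by rewrite adj_sym.
  by rewrite adj_sym.
have [|a1 [a2 [b1 [b2 T]]]] := two_triangles_exist C4G (w := w).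
  apply: card_link_eq2 => // k j j' kw wk'.
  have -> : k = z by apply: contraNeq wk' => /wk ->.
  by rewrite !zE => /eqP-> /eqP->.
case: (boolP (c \in [:: a1; a2; b1; b2])) => [|cab]; last first.
  by constructor 3; exact: isomorphic_G6 T zw wz wk zE cab.
rewrite !inE => Hc; constructor 2.
(* The symmetries of the two triangles move c to the position of a1. *)
case/or4P: Hc => /eqP Ec; rewrite Ec in zE.
- exact: isomorphic_G5 T zw wz wk zE.
- exact: isomorphic_G5 (two_triangles_swap T) zw wz wk zE.
- exact: isomorphic_G5 (two_trianglesC T) zw wz wk zE.
- exact: isomorphic_G5 (two_triangles_swap (two_trianglesC T)) zw wz wk zE.
Qed.

End Structure.

(** * Graphs of maximum degree at most n - 3 and the conclusion *)

(** This bounds d + S / d, with n = m + 8. For d >= 4 it suffices that d (m + 7 - d) >= m + 11; by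
    concavity only d = 4 and d = m + 5 matter, with values 4m + 12 and 2m + 10, and the second fails
    only for m = 0. *)
Lemma degree_ineq m d S : (0 < d <= m + 5)%N -> (S <= d * (m + 5))%N ->
  (S <= d + (m + 7))%N -> (S <= m + 11)%N ->
  (d * d + S <= (m + 7) * d)%N \/ m = 0%N /\ (5 * (d * d + S) <= 36 * d)%N.
Proof.
move=> /andP[d0 dm] S1 S2 S3.
have [d3|d4] := leqP d 3; first by left; move: d d0 dm S1 S2 d3 => [|[|[|[|]]]]; lia.
have [m0|m0] := posnP m; last by left; nia.
subst m; have {}d4 : d = 4%N \/ d = 5%N by lia.
by case: d4 => ->; [left|right]; lia.
Qed.

Lemma q_lt_G6 (R : realType) m (G : sgraph m.+4.+4) : B G ->
  (forall i, deg G i <= m + 5)%N -> q R G < q R (G6 m.+4.+4).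
Proof.
move=> bG dm; have [C4G [conG _]] := bG.
have d0 i : (0 < deg G i)%N.
  (* Any root other than i will do: the parent of i is then a neighbour of i. *)
  pose w : 'I_m.+4.+4 := if i == ord0 then ord_max else ord0.
  have iw : i != w by rewrite /w; case: (eqVneq i ord0) => [->|].
  have [p /= [pG _ _ _ _]] := spanning_edges w conG.
  by rewrite card_gt0; apply/finset.set0Pn; exists (p i); rewrite inE pG.
apply: (@q_lt R _ G (fun i => (deg G i)%:R)) => // [i|i].
  by rewrite ltr0n.
rewrite big_split /= sumr_const -natr_sum -(mulr_natr _ #|_|) -natrM.
rewrite (_ : #|_| = deg G i); last by rewrite /deg cardsE.
rewrite -natrD; set S := (\sum_(j | _) _)%N.
have S1 : (S <= deg G i * (m + 5))%N.
  by rewrite /deg cardsE -sum_nat_const; apply: leq_sum => j _; exact: dm.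
have S2 : (S <= deg G i + (m + 7))%N.
  by apply: leq_trans (sum_deg_nbr_le i C4G) _; rewrite leq_add2l !addnS addn0.
have S3 : (S <= m + 11)%N.
  by apply: leq_trans (sum_deg_nbr_le_add3 i bG) _; rewrite !addnS !addn0.
have di : (0 < deg G i <= m + 5)%N by rewrite d0 dm.
have dR : 0 < (deg G i)%:R :> R by rewrite ltr0n.
case: (degree_ineq di S1 S2 S3) => [H|[m0 H]].
  apply: le_lt_trans (_ : (m + 7)%:R * (deg G i)%:R < _).
    by rewrite -natrM ler_nat.
  by rewrite ltr_pM2r // natrD q_G6_gt_pred.
apply: le_lt_trans (_ : 36 / 5 * (deg G i)%:R < _).
  by rewrite mulrAC ler_pdivlMr // -!natrM ler_nat mulnC.
by rewrite ltr_pM2r // m0 q_G6_8_gt.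
Qed.

Theorem theorem3p3 (R : realType) (n : nat) (hn : (8 <= n)%N) (G : sgraph n)
    (hG : B G) (hG4 : ~ isomorphic G (G4 n))
    (hG5 : ~ isomorphic G (G5 n)) (hG6 : ~ isomorphic G (G6 n)) :
  [/\ q R G < q R (G6 n), q R (G6 n) < q R (G5 n)
    & q R (G5 n) < q R (G4 n)].
Proof.
case: n hn G hG hG4 hG5 hG6 => [|[|[|[|[|[|[|[|m]]]]]]]] // _ G hG hG4 hG5 hG6.
(* The order n lies between the last two eigenvalues. *)
split; last exact: lt_le_trans (q_G5_lt R m) (q_G4_ge R m).
  apply: q_lt_G6 => // w; rewrite leqNgt; apply/negP => dw.
  have [|//|//|//] := @large_degree_isomorphic _ G w hG.
  by apply: leq_trans dw; rewrite !addnS addn0.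
exact: q_G6_lt_G5.
Qed.
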